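(* Let $\mathcal{D}$ be a domain and let $\tau\in\mathcal{E}_{\mathsf{spin}}(\mathbb{Z}^2)$ be equal to $1$ at all odd faces outside $\mathcal{D}$. Suppose $a,b,c>0$ satisfy $a,b\le c$. Then the marginal of $\mathsf{Spin}_{\mathcal{D},a,b,c}^{\tau}$ on $\sigma^\bullet$ satisfies the FKG lattice condition. In particular, for any increasing functions $f,g\colon\{-1,1\}^{F^\bullet(\mathbb{Z}^2)}\to\mathbb{R}$, \[\mathsf{Spin}_{\mathcal{D},a,b,c}^{\tau}(f(\sigma^\bullet)g(\sigma^\bullet))\ge \mathsf{Spin}_{\mathcal{D},a,b,c}^{\tau}(f(\sigma^\bullet))\,\mathsf{Spin}_{\mathcal{D},a,b,c}^{\tau}(g(\sigma^\bullet)).\]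
   Context: Faces of $\mathbb{Z}^2$ are centered at integer points; the face $(i,j)$ is even if $i+j$ is even, odd otherwise; $F^\bullet(\mathbb{Z}^2)$ and $F^\circ(\mathbb{Z}^2)$ denote the sets of even and odd faces. For $\sigma\in\{-1,1\}^{F(\mathbb{Z}^2)}$, $\sigma^\bullet$ is its restriction to $F^\bullet(\mathbb{Z}^2)$; $\{-1,1\}^{F^\bullet(\mathbb{Z}^2)}$ carries the pointwise partial order. A domain is a finite subgraph of $\mathbb{Z}^2$ consisting of a simple cycle together with everything it encloses; its faces are the enclosed faces. $\mathcal{E}_{\mathsf{spin}}(\mathbb{Z}^2)$ is the set of $\sigma\colon F(\mathbb{Z}^2)\to\{-1,1\}$ such that around every vertex at least one of the two diagonal pairs of faces (faces meeting only at that vertex) has equal spins. A vertex is of type $c$ if both diagonal pairs around it have equal spins, of type $a$ if only the south-west/north-east pair does, of type $b$ if only the north-west/south-east pair does. For $a,b,c>0$ and $\tau\in\mathcal{E}_{\mathsf{spin}}(\mathbb{Z}^2)$, $\mathsf{Spin}_{\mathcal{D},a,b,c}^{\tau}$ is the probability measure on $\sigma\in\mathcal{E}_{\mathsf{spin}}(\mathbb{Z}^2)$ equal to $\tau$ on faces outside $\mathcal{D}$, with probability proportional to $a^{N_a}b^{N_b}c^{N_c}$, $N_x$ being the number of vertices of $\mathcal{D}$ of type $x$. A measure $\mu$ on a finite distributive lattice satisfies the FKG lattice condition if $\mu(x\vee y)\mu(x\wedge y)\ge\mu(x)\mu(y)$ for all $x,y$. *)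

(* Defs.v *)
From HB Require Import structures.
From mathcomp Require Import all_boot all_order all_algebra.
From mathcomp Require Import boolp reals.

Set Implicit Arguments.
Unset Strict Implicit.
Unset Printing Implicit Defensive.
Import Order.TTheory GRing.Theory Num.Theory.
Local Open Scope ring_scope.

(** * Lattice conventions
    A face of Z^2 is identified with its centre (i,j) : int * int.
    A vertex of Z^2 is a point (i+1/2, j+1/2); we index it by (i,j) : int * int,
    i.e. vertex (i,j) is the north-east corner of face (i,j).
    Around vertex (i,j): SW face (i,j), SE face (i+1,j), NW face (i,j+1),
    NE face (i+1,j+1).
    Spins are coded as booleans: true = +1, false = -1 (so the pointwise order
    on {-1,1} is the boolean order false < true). *)

Definition face := (int * int)%type.
Definition vertex := (int * int)%type.


Definition is_even_face (x : face) : bool := ~~ odd (absz (x.1 + x.2)).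
Definition is_odd_face (x : face) : bool := odd (absz (x.1 + x.2)).

Definition fSW (v : vertex) : face := (v.1, v.2).
Definition fSE (v : vertex) : face := (v.1 + 1, v.2).
Definition fNW (v : vertex) : face := (v.1, v.2 + 1).
Definition fNE (v : vertex) : face := (v.1 + 1, v.2 + 1).

Definition diagA (s : face -> bool) (v : vertex) : bool := s (fSW v) == s (fNE v).
Definition diagB (s : face -> bool) (v : vertex) : bool := s (fNW v) == s (fSE v).

Definition type_a s v := diagA s v && ~~ diagB s v.
Definition type_b s v := ~~ diagA s v && diagB s v.
Definition type_c s v := diagA s v && diagB s v.

Definition E_spin (s : face -> bool) : Prop := forall v : vertex, diagA s v || diagB s v.

(** * Domains
    A domain is given by a simple cycle of Z^2: a duplicate-free sequence of
    vertices, of length >= 3, cyclically consecutive ones being adjacent. *)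
Definition adj (u v : vertex) : bool := (absz (u.1 - v.1) + absz (u.2 - v.2) == 1)%N.

Definition simple_cycle (s : seq vertex) : Prop :=
  [/\ (3 <= size s)%N, uniq s & cycle adj s].

Definition cycle_edges (s : seq vertex) : seq (vertex * vertex) := zip s (rot 1 s).

(** the horizontal ray from the centre (i,j) of face x towards +infinity
    crosses the edge e: e is the vertical edge {(k,j-1),(k,j)} with k >= i
    (it lies at abscissa k+1/2 and spans heights [j-1/2, j+1/2]). *)
Definition ray_crosses (x : face) (e : vertex * vertex) : bool :=
  [&& e.1.1 == e.2.1, x.1 <= e.1.1 &
      ((e.1.2 == x.2 - 1) && (e.2.2 == x.2)) || ((e.1.2 == x.2) && (e.2.2 == x.2 - 1))].

(** faces enclosed by the cycle s (even-odd / ray casting rule) *)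
Definition enclosed (s : seq vertex) (x : face) : bool :=
  odd (count (ray_crosses x) (cycle_edges s)).

Definition corners (x : face) : seq vertex :=
  [:: (x.1, x.2); (x.1 - 1, x.2); (x.1, x.2 - 1); (x.1 - 1, x.2 - 1)].

(** vertices of the domain with face list F: all corners of faces of the domain
    (= vertices of the cycle and of its interior). *)
Definition dom_vertices (F : seq face) : seq vertex := undup (flatten (map corners F)).

Section SpinMeasure.
Variables (R : realType) (F : seq face) (tau : face -> bool) (a b c : R).

Definition ext (eta : {ffun seq_sub F -> bool}) (x : face) : bool :=
  match (insub x : option (seq_sub F)) with
  | Some y => eta y
  | None => tau x
  end.

Definition spin_weight (eta : {ffun seq_sub F -> bool}) : R :=
  let s := ext eta in
  if `[< E_spin s >] then
    a ^+ count (type_a s) (dom_vertices F) *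
    b ^+ count (type_b s) (dom_vertices F) *
    c ^+ count (type_c s) (dom_vertices F)
  else 0.

Definition spin_Z : R := \sum_(eta : {ffun seq_sub F -> bool}) spin_weight eta.

Definition spin_E (f : (face -> bool) -> R) : R :=
  \sum_(eta : {ffun seq_sub F -> bool}) (spin_weight eta / spin_Z) * f (ext eta).

End SpinMeasure.

Definition even_face := {x : face | is_even_face x}.
Definition restr_even (s : face -> bool) : even_face -> bool := fun x => s (sval x).

Definition conf_join (x y : even_face -> bool) : even_face -> bool := fun p => x p || y p.
Definition conf_meet (x y : even_face -> bool) : even_face -> bool := fun p => x p && y p.
Definition conf_le (x y : even_face -> bool) : Prop := forall p, x p ==> y p.

Definition spin_marginal (R : realType) (F : seq face) (tau : face -> bool) (a b c : R)
  (xi : even_face -> bool) : R :=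
  spin_E F tau a b c (fun s => if `[< restr_even s = xi >] then 1 else 0).

Definition increasing (R : realType) (f : (even_face -> bool) -> R) : Prop :=
  forall x y, conf_le x y -> f x <= f y.

(* Main.v *)
(* Fix the even spins and let S be the set of even faces of spin +. An odd
   configuration is a vector over F_2 (the set of odd faces of spin -), and the set of
   vertices whose odd diagonal disagrees depends additively on it; it is an even
   subgraph of the graph of even faces, supported on the edges joining two faces of S or
   two faces of the complement of S. Its part inside S is again even, hence, the domain
   being bounded by a simple cycle, it is the disagreement set of another odd
   configuration. The sum over odd spins therefore factors as a product of vertex
   weights, a sum indexed by S and a sum indexed by its complement. Each of these sums is
   log-supermodular in its edge weights, by a duplicated-variable argument in the style of
   Griffiths and Ginibre, and edges inside S, or inside its complement, are supermodular
   in S. Positive association follows from the lattice condition through the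
   four functions theorem. *)

Require Import Defs.
From HB Require Import structures.
From mathcomp Require Import all_boot all_order all_algebra.
From mathcomp Require Import boolp reals.
From mathcomp Require Import ring lra zify.
Import Order.TTheory GRing.Theory Num.Theory.
Set Implicit Arguments.
Unset Strict Implicit.
Unset Printing Implicit Defensive.
Local Open Scope ring_scope.

(** * Log-supermodularity of weighted sums over binary configurations *)

Section PositiveDefinite.
Variables (R : realFieldType) (I : finType).
Local Notation V := {ffun I -> bool}.

(** Addition on [V] is pointwise exclusive or, so [l] is a linear form over F_2 and the function
    (-1)^l is a character of the group [V]. *)
Definition character (l : V -> bool) := {morph l : x y / x + y >-> x (+) y}.

(** The cone spanned by the characters, that is, the functions with nonnegative Fourier
    coefficients. The inductive form lets closure properties be checked on characters. *)
Inductive posdef : (V -> R) -> Prop :=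
| posdef_char l : character l -> posdef (fun x => (-1) ^+ l x)
| posdefD f g : posdef f -> posdef g -> posdef (fun x => f x + g x)
| posdefZ k f : 0 <= k -> posdef f -> posdef (fun x => k * f x).

Lemma posdef_ext f g : posdef f -> f =1 g -> posdef g.
Proof. by move=> pf /funext <-. Qed.

Lemma posdef_cst k : 0 <= k -> posdef (fun=> k).
Proof.
move=> k0; apply: (@posdef_ext (fun x => k * (-1) ^+ false)) => [|x].
  by apply: posdefZ => //; apply: (@posdef_char (fun=> false)).
by rewrite mulr1.
Qed.

Lemma posdefM f g : posdef f -> posdef g -> posdef (fun x => f x * g x).
Proof.
elim=> [l hl|f1 f2 _ IH1 _ IH2|k f1 k0 _ IH] pg.
- elim: pg => [m hm|g1 g2 _ IH1 _ IH2|k g1 k0 _ IH].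
  + apply: (@posdef_ext (fun x => (-1) ^+ (l x (+) m x))) => [|x].
      by apply: posdef_char => x y; rewrite hl hm addbACA.
    by rewrite signr_addb.
  + by apply: (posdef_ext (posdefD IH1 IH2)) => x; rewrite mulrDr.
  + by apply: (posdef_ext (posdefZ k0 IH)) => x; rewrite mulrCA.
- by apply: (posdef_ext (posdefD (IH1 pg) (IH2 pg))) => x; rewrite mulrDl.
- by apply: (posdef_ext (posdefZ k0 (IH pg))) => x; rewrite mulrA.
Qed.

Lemma posdef_prod (E : Type) (s : seq E) (P : pred E) (f : E -> V -> R) :
  (forall e, P e -> posdef (f e)) -> posdef (fun x => \prod_(e <- s | P e) f e x).
Proof.
move=> pf; elim: s => [|e s IH].
  by apply: (posdef_ext (posdef_cst ler01)) => x; rewrite big_nil.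
case Pe : (P e).
  by apply: (posdef_ext (posdefM (pf e Pe) IH)) => x; rewrite big_cons Pe.
by apply: (posdef_ext IH) => x; rewrite big_cons Pe.
Qed.

(** A nontrivial character changes sign under translation by some [t], so its sum is 0; the trivial
    one has all terms equal to 1. *)
Lemma sum_posdef_ge0 f : posdef f -> 0 <= \sum_x f x.
Proof.
elim=> [l hl|f1 f2 _ IH1 _ IH2|k f1 k0 _ IH].
- have [[t lt]|l0] := pselect (exists t, l t).
    suff : \sum_x (-1) ^+ l x = - \sum_x (-1) ^+ l x :> R by lra.
    rewrite {1}(reindex_inj (addIr t)) -sumrN; apply: eq_bigr => x _.
    by rewrite hl lt addbT signrN.
  by apply: sumr_ge0 => x _; case lx: (l x) => //; case: l0; exists x.
- by rewrite big_split addr_ge0.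
- by rewrite -mulr_sumr mulr_ge0.
Qed.

(** The shift by [t] multiplies each character by a sign, so the difference multiplies its
    coefficient by 0 or 2. *)
Lemma posdef_shift f t : posdef f -> posdef (fun x => f x - f (x + t)).
Proof.
elim=> [l hl|f1 f2 _ IH1 _ IH2|k f1 k0 _ IH].
- apply: (@posdef_ext (fun x => (1 - (-1) ^+ l t) * (-1) ^+ l x)) => [|x].
    apply: posdefZ; last exact: posdef_char.
    by rewrite subr_ge0; case: (l t); rewrite ?expr1 ?expr0 //; lra.
  by rewrite hl signr_addb; ring.
- by apply: (posdef_ext (posdefD IH1 IH2)) => x; ring.
- by apply: (posdef_ext (posdefZ k0 IH)) => x; ring.
Qed.

Lemma posdef_correlation f g t : posdef f -> posdef g ->
  \sum_x f x * g (x + t) <= \sum_x f x * g x.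
Proof.
move=> pf pg; rewrite -subr_ge0 -sumrB.
have := sum_posdef_ge0 (posdefM pf (posdef_shift t pg)).
by congr (0 <= _); apply: eq_bigr => x _; rewrite mulrBr.
Qed.

Lemma posdef_if l p q : character l -> 0 <= q <= p ->
  posdef (fun x => if l x then q else p).
Proof.
move=> hl qp.
(* The Fourier coefficients are the mean and half the difference of [p] and [q]. *)
apply: (@posdef_ext (fun x => (p + q) / 2 + (p - q) / 2 * (-1) ^+ l x)) => [|x].
  by apply: posdefD; [apply: posdef_cst|apply: posdefZ; [|exact: posdef_char]]; lra.
by case: (l x); rewrite ?expr1 ?expr0; lra.
Qed.

End PositiveDefinite.

(** * Weight enumerators of binary linear codes *)

Section CodeSum.
Variables (R : realFieldType) (I : finType) (E : Type) (s : seq E).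
Variable d : E -> {ffun I -> bool} -> bool.
Hypothesis d_char : forall e, character (d e).
Local Notation V := {ffun I -> bool}.

(** Up to a multiplicity, the weight enumerator of the binary code of vectors (d e x)_e. A weight
    [t e = 0] kills the terms with [d e x] true and leaves the others alone, as 0 ^+ 0 is 1. *)
Definition code_sum (t : E -> R) : R := \sum_(x : V) \prod_(e <- s) t e ^+ d e x.

Lemma code_sum_ge0 t : (forall e, 0 <= t e) -> 0 <= code_sum t.
Proof.
by move=> t0; apply: sumr_ge0 => x _; apply: prodr_ge0 => e _; apply: exprn_ge0.
Qed.

Lemma ler_code_sum t u : (forall e, 0 <= t e <= u e) -> code_sum t <= code_sum u.
Proof.
move=> tu; apply: ler_sum => x _; apply: ler_prod => e _.
by case: (d e x); rewrite ?expr1 ?expr0 ?lexx ?ler01 ?tu.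
Qed.

(* Writing the second variable of a pair as x + y and fixing y, both sides are
   sums over x of the same product, up to the shift by y of the factors with
   [d e y] and [u e < t e]. *)
Lemma code_sum_supermodular t u :
  (forall e, 0 <= t e <= 1) -> (forall e, 0 <= u e <= 1) ->
  code_sum t * code_sum u <=
  code_sum (fun e => Num.max (t e) (u e)) * code_sum (fun e => Num.min (t e) (u e)).
Proof.
move=> t01 u01.
have dE (v w : E -> R) : code_sum v * code_sum w =
    \sum_y \sum_x \prod_(e <- s) (v e ^+ d e x * w e ^+ (d e x (+) d e y)).
  rewrite /code_sum mulr_suml exchange_big /=; apply: eq_bigr => x _.
  rewrite mulr_sumr (reindex_inj (addrI x)); apply: eq_bigr => y _.
  by rewrite -big_split; apply: eq_bigr => e _; rewrite d_char.
rewrite !dE; apply: ler_sum => y _.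
(* [psi] puts the larger value where [d e x] is false, which makes it positive definite; the factor
   on the right-hand side has the opposite orientation, hence is [psi] shifted by [y]. When [d e y]
   is false, positivity comes from the bound by 1. *)
pose psi e x := if d e x then Num.min (t e) (u e) else Num.max (t e) (u e).
pose P e := d e y && (u e < t e).
pose phi e x := if d e y then psi e x else
                 if d e x then Num.min (t e) (u e) * Num.max (t e) (u e) else 1.
have mM e : 0 <= Num.min (t e) (u e) <= Num.max (t e) (u e) /\ Num.max (t e) (u e) <= 1.
  by have := t01 e; have := u01 e; case: (ltP (t e) (u e)) => /=; lra.
have pphi e : posdef (phi e).
  rewrite /phi /psi; case: (d e y).
    by apply: posdef_if => //; case: (mM e).
  apply: posdef_if => //; case: (mM e) => /andP[m0 mM'] M1.
  by apply/andP; split; [apply: mulr_ge0|apply: mulr_ile1]; lra.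
have := @posdef_correlation R I _ _ y
  (@posdef_prod R I E s (fun e => ~~ P e) phi (fun e _ => pphi e))
  (@posdef_prod R I E s P phi (fun e _ => pphi e)).
rewrite [X in _ <= X -> _](reindex_inj (addIr y)) /=.
congr (_ <= _); apply: eq_bigr => x _; rewrite [RHS](bigID P) mulrC /=;
  congr (_ * _); apply: eq_bigr => e; rewrite /P /phi /psi ?d_char;
  case: (d e y); case: (d e x) => //=; rewrite ?expr1 ?expr0 ?mulr1 ?mul1r //;
  by case: (ltP (t e) (u e)) => //=; lra.
Qed.

End CodeSum.

(** * The four functions theorem *)

Section FourFunctions.
Variables (R : realFieldType) (I : finType).
Local Notation X := {ffun I -> bool}.

Definition fjoin (x y : X) : X := [ffun i => x i || y i].
Definition fmeet (x y : X) : X := [ffun i => x i && y i].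
Definition fupd (x : X) (i : I) (b : bool) : X := [ffun j => if j == i then b else x j].
(** Sums out one coordinate while staying on the same index type; the result no longer depends on
    [x i], and totals are doubled. *)
Definition sum_at (i : I) (f : X -> R) (x : X) : R := f (fupd x i true) + f (fupd x i false).

Definition four_le (a b c d : X -> R) :=
  forall x y, a x * b y <= c (fjoin x y) * d (fmeet x y).

(** Only the mixed terms p, q against r, s need work: from p, q <= r and p q <= r s, the inequality
    (r - p)(r - q) >= 0 gives r (p + q) <= r (r + s). *)
Lemma four_le_bool (a0 a1 b0 b1 c0 c1 d0 d1 : R) :
  0 <= a0 -> 0 <= a1 -> 0 <= b0 -> 0 <= b1 -> 0 <= c0 -> 0 <= c1 -> 0 <= d0 -> 0 <= d1 ->
  a0 * b0 <= c0 * d0 -> a0 * b1 <= c1 * d0 -> a1 * b0 <= c1 * d0 -> a1 * b1 <= c1 * d1 ->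
  (a1 + a0) * (b1 + b0) <= (c1 + c0) * (d1 + d0).
Proof.
move=> ? ? ? ? ? ? ? ? h00 h01 h10 h11.
suff : a0 * b1 + a1 * b0 <= c1 * d0 + c0 * d1 by lra.
set p := a0 * b1 in h01 *; set q := a1 * b0 in h10 *; set r := c1 * d0 in h01 h10 *.
have p0 : 0 <= p by apply: mulr_ge0.
have q0 : 0 <= q by apply: mulr_ge0.
have s0 : 0 <= c0 * d1 by apply: mulr_ge0.
have pq : p * q <= r * (c0 * d1).
  have -> : p * q = (a0 * b0) * (a1 * b1) by rewrite /p /q; ring.
  have -> : r * (c0 * d1) = (c0 * d0) * (c1 * d1) by rewrite /r; ring.
  by apply: ler_pM => //; apply: mulr_ge0.
have [r0|r0] := ltP 0 r; last by lra.
rewrite -(ler_pM2l r0).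
have : 0 <= (r - p) * (r - q) by apply: mulr_ge0; lra.
lra.
Qed.

Lemma four_le_sum_at i (a b c d : X -> R) :
  (forall x, 0 <= a x) -> (forall x, 0 <= b x) ->
  (forall x, 0 <= c x) -> (forall x, 0 <= d x) ->
  four_le a b c d -> four_le (sum_at i a) (sum_at i b) (sum_at i c) (sum_at i d).
Proof.
move=> a0 b0 c0 d0 abcd x y.
have joinE u v : fjoin (fupd x i u) (fupd y i v) = fupd (fjoin x y) i (u || v).
  by apply/ffunP => j; rewrite !ffunE; case: eqP.
have meetE u v : fmeet (fupd x i u) (fupd y i v) = fupd (fmeet x y) i (u && v).
  by apply/ffunP => j; rewrite !ffunE; case: eqP.
have h u v := abcd (fupd x i u) (fupd y i v).
apply: four_le_bool => //; rewrite -?(joinE, meetE).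
- by have := h false false; rewrite joinE meetE.
- by have := h false true; rewrite joinE meetE.
- by have := h true false; rewrite joinE meetE.
- by have := h true true; rewrite joinE meetE.
Qed.

Lemma sum_sum_at i (f : X -> R) : \sum_x sum_at i f x = (\sum_x f x) *+ 2.
Proof.
(* Up to order, the two terms of [sum_at i f x] are [f x] and [f (flip x)]. *)
pose flip (x : X) : X := [ffun j => (j == i) (+) x j].
have flipK : involutive flip.
  by move=> x; apply/ffunP => j; rewrite !ffunE addKb.
transitivity (\sum_x (f x + f (flip x))).
  apply: eq_bigr => x _; rewrite /sum_at.
  have [xi|xi] := boolP (x i); [|rewrite addrC]; congr (f _ + f _);
  apply/ffunP => j; rewrite !ffunE; have [->|] //= := eqVneq j i;
  by move: xi; case: (x i).
by rewrite big_split /= [X in _ + X](reindex_inj (inv_inj flipK)) /= mulr2n;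
  congr (_ + _); apply: eq_bigr => x _; rewrite flipK.
Qed.

Definition sum_all (s : seq I) (f : X -> R) : X -> R := foldr sum_at f s.

Lemma sum_sum_all s f : \sum_x sum_all s f x = (\sum_x f x) *+ 2 ^ size s.
Proof.
elim: s => [|i s IH] //=.
by rewrite sum_sum_at IH -mulrnA -expnSr.
Qed.

Lemma sum_all_upd s f x i b : i \in s -> sum_all s f (fupd x i b) = sum_all s f x.
Proof.
elim: s x => [|j s IH] x //=; rewrite inE /sum_at.
have [-> _|ij /= si] := eqVneq i j.
  by congr (_ + _); congr (sum_all _ _ _); apply/ffunP => k; rewrite !ffunE; case: eqP.
have E c : fupd (fupd x i b) j c = fupd (fupd x j c) i b.
  apply/ffunP => k; rewrite !ffunE; have [->|//] := eqVneq k j.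
  by rewrite eq_sym (negbTE ij).
by rewrite !E !IH.
Qed.

Lemma sum_all_const s f x y : {subset enum I <= s} -> sum_all s f x = sum_all s f y.
Proof.
move=> sub.
(* [z] is turned into [y] one coordinate at a time; [r] lists the coordinates where they may
   differ. *)
suff H (r : seq I) (z : X) : (forall i, i \notin r -> z i = y i) -> sum_all s f z = sum_all s f y.
  by apply: (H (enum I)) => i; rewrite mem_enum.
elim: r z => [|i r IH] z zy; first by congr (sum_all _ _ _); apply/ffunP => i; exact: zy.
rewrite -(@sum_all_upd s f z i (y i)) ?sub ?mem_enum //; apply: IH => j jr.
rewrite ffunE; have [->//|ji] := eqVneq j i.
by apply: zy; rewrite inE negb_or ji.
Qed.

(* [sum_all (enum I) f] is constant, and its total is [2 ^ #|I|] times that of [f]. *)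
Lemma sum_allE f x : sum_all (enum I) f x = \sum_x f x.
Proof.
have := sum_sum_all (enum I) f.
rewrite (eq_bigr (fun=> sum_all (enum I) f x)) => [|y _]; last exact: sum_all_const.
rewrite sumr_const card_ffun card_bool -cardE => /eqP.
by rewrite -subr_eq0 -mulrnBl mulrn_eq0 expn_eq0 /= subr_eq0 => /eqP.
Qed.

Lemma four_functions (a b c d : X -> R) :
  (forall x, 0 <= a x) -> (forall x, 0 <= b x) ->
  (forall x, 0 <= c x) -> (forall x, 0 <= d x) ->
  four_le a b c d ->
  (\sum_x a x) * (\sum_x b x) <= (\sum_x c x) * (\sum_x d x).
Proof.
move=> a0 b0 c0 d0 abcd.
have ge0 s f x : (forall x, 0 <= f x) -> 0 <= sum_all s f x.
  by move=> f0; elim: s x => [|i s IH] x //=; apply: addr_ge0.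
have H s : four_le (sum_all s a) (sum_all s b) (sum_all s c) (sum_all s d).
  by elim: s => //= i s IH; apply: four_le_sum_at => // x; apply: ge0.
by have := H (enum I) [ffun=> false] [ffun=> false]; rewrite !sum_allE.
Qed.

Lemma fkg (w f g : X -> R) :
  (forall x, 0 <= w x) ->
  (forall x y : X, w x * w y <= w (fjoin x y) * w (fmeet x y)) ->
  (forall x y : X, (forall i, x i ==> y i) -> f x <= f y) ->
  (forall x y : X, (forall i, x i ==> y i) -> g x <= g y) ->
  (\sum_x w x * f x) * (\sum_x w x * g x) <=
  (\sum_x w x * (f x * g x)) * (\sum_x w x).
Proof.
move=> w0 ww incf incg.
(* Subtracting the value at the least configuration makes both functions nonnegative, as the four
   functions theorem requires; the covariance is unaffected by constants. *)
pose o : X := [ffun=> false]; pose f' x := f x - f o; pose g' x := g x - g o.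
have f0 x : 0 <= f' x by rewrite subr_ge0; apply: incf => i; rewrite ffunE.
have g0 x : 0 <= g' x by rewrite subr_ge0; apply: incg => i; rewrite ffunE.
have := @four_functions (fun x => w x * f' x) (fun x => w x * g' x)
  (fun x => w x * (f' x * g' x)) w.
move=> /(_ _ _ _ _ _) H.
have {}H : (\sum_x w x * f' x) * (\sum_x w x * g' x) <=
           (\sum_x w x * (f' x * g' x)) * (\sum_x w x).
  apply: H => [x|x|x|//|x y]; rewrite ?mulr_ge0 //.
  rewrite mulrACA [leRHS]mulrAC; apply: ler_pM; rewrite ?mulr_ge0 //.
  apply: ler_pM => //; rewrite lerB // ?incf ?incg // => i; rewrite ffunE.
    by apply/implyP => ->.
  by apply/implyP => ->; rewrite orbT.
have E (h : X -> R) k : \sum_x w x * (h x - k) = \sum_x w x * h x - k * \sum_x w x.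
  by rewrite mulr_sumr -sumrB; apply: eq_bigr => x _; ring.
have Efg : \sum_x w x * (f' x * g' x) = \sum_x w x * (f x * g x)
    - g o * \sum_x w x * f x - f o * \sum_x w x * g x + f o * g o * \sum_x w x.
  by rewrite !mulr_sumr -!sumrB -big_split; apply: eq_bigr => x _; rewrite /f' /g' /=; ring.
by move: H; rewrite Efg !E; lra.
Qed.

End FourFunctions.

(** * Connectedness of the exterior of a simple cycle *)

Lemma int_shift_const (T : Type) (P : int -> T) :
  (forall i, P i = P (i + 1)) -> forall i (n : nat), P i = P (i + n%:Z).
Proof. by move=> PS i; elim=> [|n ->]; [rewrite addr0|rewrite PS; congr P; lia]. Qed.

(** Used along rows and diagonals to show that a defect is zero: it is constant along the line and
    vanishes far away. *)
Lemma int_shift_false (P : int -> bool) (B : int) :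
  (forall i, P i = P (i + 1)) -> (forall i, B <= i -> P i = false) ->
  forall i, P i = false.
Proof. by move=> PS PB i; rewrite (int_shift_const PS i `|B - i|); apply: PB; lia. Qed.

Lemma exists_bound (s : seq face) : exists B : int, forall x, x \in s -> x.1 < B.
Proof.
elim: s => [|x s [B HB]]; first by exists 0.
exists (Num.max B (x.1 + 1)) => y; rewrite inE lt_max => /orP[/eqP->|/HB->] //.
by rewrite ltrDl orbT.
Qed.

Section Exterior.
Variables (cyc : seq vertex) (F : seq face).
Hypothesis scyc : simple_cycle cyc.
Hypothesis FE : forall x, (x \in F) = enclosed cyc x.

Local Notation edges := (cycle_edges cyc).

(* Counted modulo 2, [multiplicity] is the coboundary of [enclosed]. *)
Definition is_edge (p q : vertex) (e : vertex * vertex) := (e == (p, q)) || (e == (q, p)).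
Definition multiplicity p q := count (is_edge p q) edges.

(** The rays from the two faces differ exactly by the vertical edge between these faces. *)
Lemma enclosed_step i j :
  enclosed cyc (i, j) = odd (multiplicity (i, j - 1) (i, j)) (+) enclosed cyc (i + 1, j).
Proof.
rewrite /enclosed /multiplicity -oddD; congr odd.
elim: edges => [//|[[p1 p2] [q1 q2]] s IH] /=; rewrite {}IH addnACA; congr (_ + _)%N.
by rewrite /ray_crosses /is_edge !xpair_eqE /=; lia.
Qed.

Lemma cycle_edgesP e : e \in edges -> adj e.1 e.2.
Proof.
have [_ _] := scyc; rewrite /cycle_edges.
case: (cyc) => [//|x s] /= cs.
rewrite rot1_cons; elim: s {1 3}x cs => [|z s IH] y /=.
  by rewrite andbT => h; rewrite inE => /eqP->.
move=> /andP[h cs]; rewrite inE => /orP[/eqP-> //|]; exact: IH.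
Qed.

(** Incidences are counted edge by edge: each vertex of the cycle is the source of one entry of
    [cycle_edges] and the target of one. *)
Lemma vertex_degree (i j : int) :
  (multiplicity (i, (j - 1)%R) (i, j) + multiplicity (i, j) (i, (j + 1)%R) +
   multiplicity ((i - 1)%R, j) (i, j) + multiplicity (i, j) ((i + 1)%R, j) =
   2 * ((i, j) \in cyc))%N.
Proof.
have [_ ucyc _] := scyc.
have deg : (2 * ((i, j) \in cyc) = \sum_(e <- edges) ((e.1 == (i, j)) + (e.2 == (i, j))))%N.
  have sumE (Q : pred (vertex * vertex)) :
      (\sum_(e <- edges) Q e = count Q edges)%N.
    by rewrite -sum1_count [RHS]big_mkcond.
  rewrite big_split /= !sumE -(count_map fst (pred1 (i, j))) -(count_map snd (pred1 (i, j))).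
  rewrite -/(unzip1 _) -/(unzip2 _) unzip1_zip ?unzip2_zip ?size_rot //.
  by rewrite !count_uniq_mem ?rot_uniq // mem_rot mul2n addnn.
rewrite deg /multiplicity -!sum1_count !(big_mkcond (is_edge _ _)) -!big_split /=.
rewrite big_seq [RHS]big_seq; apply: eq_bigr => [[[p1 p2] [q1 q2]]] /cycle_edgesP /=.
have nE (x y : int) : (x + 1 == y) = (x == y - 1) by lia.
have nE' (x y : int) : (x - 1 == y) = (x == y + 1) by lia.
move=> pq.
have [[-> ->]|[[-> ->]|[[-> ->]|[-> ->]]]] : (q1 = p1 + 1 /\ q2 = p2) \/
    (q1 = p1 - 1 /\ q2 = p2) \/ (q1 = p1 /\ q2 = p2 + 1) \/ (q1 = p1 /\ q2 = p2 - 1).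
  by move: pq; rewrite /adj /=; lia.
all: rewrite /is_edge !xpair_eqE /= ?nE ?nE' ?addrK ?subrK.
all: have excl (x y : int) : [&& ~~ ((x == y) && (x == y - 1)),
    ~~ ((x == y) && (x == y + 1)), ~~ ((x == y - 1) && (x == y + 1)),
    ~~ ((x == y) && (x == y - 1 - 1)) & ~~ ((x == y) && (x == y + 1 + 1))] by lia.
all: move: (excl p1 i).
all: case: (p1 == i) (p1 == i - 1) (p1 == i + 1) (p1 == i - 1 - 1) (p1 == i + 1 + 1).
all: move=> [] [] [] [] // _.
all: move: (excl p2 j).
all: case: (p2 == j) (p2 == j - 1) (p2 == j + 1) (p2 == j - 1 - 1) (p2 == j + 1 + 1).
all: by move=> [] [] [] [].
Qed.

(** Length at least 3 rules out the reversed entry, whose presence would make the multiplicity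
    even. *)
Lemma multiplicity_next k : (k.+1 < size cyc)%N ->
  multiplicity (nth (0, 0) cyc k) (nth (0, 0) cyc k.+1) = 1%N.
Proof.
have [size3 ucyc _] := scyc; move=> ks.
set p := nth _ _ k; set q := nth _ _ k.+1.
have szr : size (rot 1 cyc) = size cyc by rewrite size_rot.
have nthr m : (m < size cyc)%N ->
    nth (0, 0) (rot 1 cyc) m = nth (0, 0) cyc (if m.+1 == size cyc then 0%N else m.+1).
  case: (cyc) => [//|x s] /=; rewrite rot1_cons nth_rcons ltnS eqSS.
  by case: ltngtP.
have nthe m : (m < size cyc)%N -> nth ((0, 0), (0, 0)) edges m =
    (nth (0, 0) cyc m, nth (0, 0) (rot 1 cyc) m).
  by move=> ms; rewrite nth_zip.
have sze : size edges = size cyc by rewrite size_zip szr minnn.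
have pq_in : (p, q) \in edges.
  apply/(nthP ((0, 0), (0, 0))); exists k; first by rewrite sze; apply: ltnW.
  by rewrite nthe ?nthr ?ltn_eqF // ltnW.
have qp_notin : (q, p) \notin edges.
  apply/negP => /(nthP ((0, 0), (0, 0)))[m]; rewrite sze => ms; rewrite nthe // => -[].
  move=> /eqP; rewrite nth_uniq // => /eqP->; rewrite nthr //.
  have kn : (k < size cyc)%N by apply: ltnW.
  case: eqP => [e|/eqP ne] /eqP; rewrite nth_uniq //.
  (* The closing edge of the cycle could be the reversed one only on a cycle of length 2. *)
  - by move=> /eqP k0; move: size3; rewrite -e -k0.
  - by apply: leq_trans size3.
  - by rewrite -[X in _ == X]addn0 -addn2 eqn_add2l.
  - by rewrite ltn_neqAle ne.
have pq : (p, q) != (q, p) by apply: contraNneq qp_notin => <-.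
have uedges : uniq edges by apply: zip_uniql.
rewrite /multiplicity /is_edge.
rewrite (eq_in_count (a2 := pred1 (p, q))) ?count_uniq_mem ?pq_in // => e eE /=.
by have [->|_] //= := eqVneq e (p, q); apply: contraNF qp_notin => /eqP <-.
Qed.

(** The rays being horizontal, this is indirect: since degrees are even, the difference of the two
    sides does not change with [i], and it vanishes far to the right. *)
Lemma enclosed_step_vertical (i j : int) :
  enclosed cyc (i, j) (+) enclosed cyc (i, j + 1) = odd (multiplicity (i - 1, j) (i, j)).
Proof.
have [B HB] := exists_bound F; have [C HC] := exists_bound cyc.
suff H : enclosed cyc (i, j) (+) enclosed cyc (i, j + 1)
           (+) odd (multiplicity (i - 1, j) (i, j)) = false.
  by move/eqP: H; rewrite eqbF_neg negb_add => /eqP.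
pose P i := enclosed cyc (i, j) (+) enclosed cyc (i, j + 1)
           (+) odd (multiplicity (i - 1, j) (i, j)).
apply: (@int_shift_false P (Num.max B C)) => [k|k].
  rewrite /P !(enclosed_step k) !addrK.
  have /(congr1 odd) := vertex_degree k j; rewrite mul2n odd_double !oddD.
  by do 4 case: (odd _); do 2 case: (enclosed _ _).
rewrite ge_max => /andP[Bk Ck]; rewrite /P.
have Fk l : enclosed cyc (k, l) = false by rewrite -FE; apply/negP => /HB /=; lia.
rewrite !Fk /=; have := vertex_degree k j.
have -> : (k, j) \in cyc = false by apply/negP => /HC /=; lia.
by case: (multiplicity (k - 1, j) _) => // n; rewrite addnS.
Qed.

Variables (h : face -> bool) (B : int).
Hypothesis hF : forall x, x \in F -> h x = false.
Hypothesis h_horizontal : forall i j,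
  (i, j) \notin F -> (i + 1, j) \notin F -> h (i, j) = h (i + 1, j).
Hypothesis h_vertical : forall i j,
  (i, j) \notin F -> (i, j + 1) \notin F -> h (i, j) = h (i, j + 1).
Hypothesis h_far : forall i j, B <= i -> h (i, j) = false.

Local Notation hdiff i j := (h (i, j) (+) h (i + 1, j)).
Local Notation vdiff i j := (h (i, j) (+) h (i, j + 1)).

(** Across an edge of even multiplicity, the two faces are both in [F], where [h] is 0, or both
    outside, where [h] is locally constant. *)
Lemma hdiff_edge i j : hdiff i j -> odd (multiplicity (i, j - 1) (i, j)).
Proof.
apply: contraTT => nodd; have := enclosed_step i j; rewrite (negbTE nodd) -!FE /=.
case iF : ((i, j) \in F) => /esym i1F; first by rewrite !hF.
by rewrite h_horizontal ?addbb ?iF ?i1F.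
Qed.

Lemma vdiff_edge i j : vdiff i j -> odd (multiplicity (i - 1, j) (i, j)).
Proof.
apply: contraTT => nodd; have := enclosed_step_vertical i j.
rewrite (negbTE nodd) -!FE => /eqP.
rewrite eqbF_neg negb_add => /eqP; case iF : ((i, j) \in F) => /esym i1F.
  by rewrite !hF.
by rewrite h_vertical ?addbb ?iF ?i1F.
Qed.

(* Either [h] jumps across every edge of the cycle at [q], as the indicator function of
   [F] does, or across none; the alternative is the same all along the cycle. *)
Definition jumps_all (q : vertex) :=
  [&& hdiff q.1 q.2 == odd (multiplicity (q.1, q.2 - 1) q),
      hdiff q.1 (q.2 + 1) == odd (multiplicity q (q.1, q.2 + 1)),
      vdiff q.1 q.2 == odd (multiplicity (q.1 - 1, q.2) q) &
      vdiff (q.1 + 1) q.2 == odd (multiplicity q (q.1 + 1, q.2))].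

Definition jumps_none (q : vertex) :=
  [&& ~~ hdiff q.1 q.2, ~~ hdiff q.1 (q.2 + 1), ~~ vdiff q.1 q.2 & ~~ vdiff (q.1 + 1) q.2].

(* The jumps of h around a vertex have even parity and lie on the cycle, which
   has degree 0 or 2 there. *)
Lemma jumps_all_or_none q : jumps_all q || jumps_none q.
Proof.
case: q => i j; rewrite /jumps_all /jumps_none /=.
have := @hdiff_edge i (j + 1); have := @vdiff_edge (i + 1) j; rewrite !addrK.
have := @hdiff_edge i j; have := @vdiff_edge i j; have := vertex_degree i j.
move: (multiplicity _ _) (multiplicity _ _) (multiplicity _ _) (multiplicity _ _).
move=> m1 m2 m3 m4; case: (_ \in _);
  case: m1 => [|[|[|m1]]]; case: m2 => [|[|[|m2]]] //; case: m3 => [|[|[|m3]]] //;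
  case: m4 => [|[|[|m4]]] //= _;
  case: (h (i, j)); case: (h (i + 1, j)); case: (h (i, j + 1));
  by case: (h (i + 1, j + 1)) => //= v1 v2 v3 v4;
     first [have := v1 isT|have := v2 isT|have := v3 isT|have := v4 isT].
Qed.

Lemma jumps_notin q : q \notin cyc -> jumps_all q /\ jumps_none q.
Proof.
case: q => i j qcyc; rewrite /jumps_all /jumps_none /=.
have := @hdiff_edge i (j + 1); have := @vdiff_edge (i + 1) j; rewrite !addrK.
have := @hdiff_edge i j; have := @vdiff_edge i j; have := vertex_degree i j.
rewrite (negbTE qcyc) muln0 => /eqP; rewrite !addn_eq0.
move=> /andP[/andP[/andP[/eqP-> /eqP->] /eqP->] /eqP->] /=.
by do 4 case: (_ (+) _) => [/(_ isT)|_] //.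
Qed.

(** The two vertices share an edge of the cycle, and [h] either jumps across it or does not. *)
Lemma jumps_edge p q : adj p q -> odd (multiplicity p q) ->
  ~~ (jumps_all p && jumps_none q) /\ ~~ (jumps_none p && jumps_all q).
Proof.
have mC u v : multiplicity u v = multiplicity v u.
  by apply: eq_count => e; rewrite /is_edge orbC.
case: p q => [p1 p2] [q1 q2] pq; rewrite /jumps_all /jumps_none.
have [[-> ->]|[[-> ->]|[[-> ->]|[-> ->]]]] : (q1 = p1 + 1 /\ q2 = p2) \/
    (q1 = p1 - 1 /\ q2 = p2) \/ (q1 = p1 /\ q2 = p2 + 1) \/ (q1 = p1 /\ q2 = p2 - 1).
  by move: pq; rewrite /adj /=; lia.
all: move=> /= modd; rewrite ?addrK ?subrK.
- rewrite modd; case: (vdiff (p1 + 1) p2) => /=; rewrite ?andbF //.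
- rewrite mC in modd; rewrite modd; case: (vdiff p1 p2) => /=; rewrite ?andbF //.
- rewrite modd; case: (hdiff p1 (p2 + 1)) => /=; rewrite ?andbF //.
- rewrite mC in modd; rewrite modd; case: (hdiff p1 p2) => /=; rewrite ?andbF //.
Qed.

(** Connectedness in terms of locally constant functions. If [h] jumps across the whole cycle, [h]
    plus the indicator of [F] is constant along rows, hence 0; otherwise [h] itself is constant
    along rows. *)
Lemma exterior_connected x : h x = false.
Proof.
have [size3 _ _] := scyc.
have adjn k : (k.+1 < size cyc)%N -> adj (nth (0, 0) cyc k) (nth (0, 0) cyc k.+1).
  have [_ _] := scyc; case: (cyc) => [//|y s] /= /(pathP (0, 0)) cs; rewrite ltnS => ks.
  have := cs k; rewrite size_rcons ltnS ltnW // => /(_ isT).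
  by rewrite -rcons_cons !nth_rcons /= ks ltnS ltnW.
have all0 k : (k < size cyc)%N -> jumps_all (nth (0, 0) cyc k) = jumps_all (nth (0, 0) cyc 0).
  elim: k => [//|k IH] ks; rewrite -IH; last exact: ltnW.
  have [] := jumps_edge (adjn k ks); first by rewrite multiplicity_next.
  have := jumps_all_or_none (nth (0, 0) cyc k).
  have := jumps_all_or_none (nth (0, 0) cyc k.+1).
  by do 2 case: (jumps_all _); do 2 case: (jumps_none _).
case: x => i j; have [C HC] := exists_bound F.
have [full|nfull] := boolP (jumps_all (nth (0, 0) cyc 0)).
- have allq q : jumps_all q.
    have [/(nthP (0, 0))[k ks <-]|/jumps_notin[]//] := boolP (q \in cyc).
    by rewrite all0.
  suff H : h (i, j) (+) ((i, j) \in F) = false.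
    by have [/hF//|iF] := boolP ((i, j) \in F); rewrite (negbTE iF) addbF in H.
  apply: (@int_shift_false (fun i => h (i, j) (+) ((i, j) \in F)) (Num.max B C)) => k.
    have /and4P[/eqP /= hk _ _ _] := allq (k, j).
    rewrite !FE enclosed_step -hk.
    by case: (h (k, j)); case: (h (k + 1, j)); case: (enclosed _ _).
  rewrite ge_max => /andP[Bk Ck]; rewrite h_far //=.
  by apply/negP => /HC /=; lia.
- have noneq q : jumps_none q.
    have [/(nthP (0, 0))[k ks <-]|/jumps_notin[]//] := boolP (q \in cyc).
    by have := jumps_all_or_none (nth (0, 0) cyc k); rewrite all0 // (negbTE nfull).
  apply: (@int_shift_false (fun i => h (i, j)) B) => k; last exact: h_far.
  have /and4P[/= hk _ _ _] := noneq (k, j).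
  by move: hk; case: (h (k, j)); case: (h (k + 1, j)).
Qed.

End Exterior.

(** * Splitting an odd configuration along the even spins *)

Lemma ext_notin F (tau : face -> bool) (eta : {ffun seq_sub F -> bool}) x :
  x \notin F -> ext tau eta x = tau x.
Proof. by move=> xF; rewrite /ext insubN. Qed.

Lemma ext_val F (tau : face -> bool) (eta : {ffun seq_sub F -> bool}) (y : seq_sub F) :
  ext tau eta (val y) = eta y.
Proof. by rewrite /ext valK. Qed.

Lemma ext_false_add F (x : face) :
  {morph (fun o : {ffun seq_sub F -> bool} => ext (fun=> false) o x) : o o' / o + o' >-> o (+) o'}.
Proof. by move=> o o'; rewrite /ext; case: insub => // y; rewrite !ffunE. Qed.

Lemma mem_dom_vertices F v x : x \in F -> v \in corners x -> v \in dom_vertices F.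
Proof.
move=> xF vx; rewrite mem_undup; apply/flattenP; exists (corners x) => //.
exact: map_f.
Qed.

(* The two even (odd) faces around a vertex are diagonally opposite; which
   diagonal it is depends on the parity of the south-west face. *)
Definition evenA (v : vertex) : face := if is_even_face v then fSW v else fNW v.
Definition evenB (v : vertex) : face := if is_even_face v then fNE v else fSE v.
Definition oddA (v : vertex) : face := if is_even_face v then fNW v else fSW v.
Definition oddB (v : vertex) : face := if is_even_face v then fSE v else fNE v.

Lemma is_odd_faceE x : is_odd_face x = ~~ is_even_face x.
Proof. by rewrite /is_even_face negbK. Qed.

Lemma even_horizontal i j : is_even_face (i + 1, j) = ~~ is_even_face (i, j).
Proof. by rewrite /is_even_face /=; lia. Qed.

Lemma even_vertical i j : is_even_face (i, j + 1) = ~~ is_even_face (i, j).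
Proof. by rewrite /is_even_face /=; lia. Qed.

Lemma evenA_even v : is_even_face (evenA v).
Proof.
by case: v => i j; rewrite /evenA; case: ifP => //; rewrite /fNW even_vertical => ->.
Qed.

Lemma evenB_even v : is_even_face (evenB v).
Proof.
case: v => i j; rewrite /evenB; case: ifP => e; rewrite /fNE /fSE /=.
  by rewrite even_horizontal even_vertical negbK.
by rewrite even_horizontal e.
Qed.

Lemma oddA_odd v : is_odd_face (oddA v).
Proof.
case: v => i j; rewrite /oddA is_odd_faceE; case: ifP => e; rewrite /fNW /fSW /=.
  by rewrite even_vertical e.
by rewrite e.
Qed.

Lemma oddB_odd v : is_odd_face (oddB v).
Proof.
case: v => i j; rewrite /oddB is_odd_faceE; case: ifP => e; rewrite /fSE /fNE /=.
  by rewrite even_horizontal e.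
by rewrite even_horizontal even_vertical e.
Qed.

Lemma corners_diag v x :
  x \in [:: fSW v; fSE v; fNW v; fNE v] -> v \in corners x.
Proof.
case: v => i j; rewrite !inE => /or4P[]/eqP->; rewrite !xpair_eqE /=; lia.
Qed.

Section Splitting.
Variables (cyc : seq vertex) (F : seq face).
Hypothesis scyc : simple_cycle cyc.
Hypothesis FE : forall x, (x \in F) = enclosed cyc x.

Local Notation Fo := [seq x <- F | is_odd_face x].
Local Notation D := (dom_vertices F).
Local Notation odd_conf := {ffun seq_sub Fo -> bool}.

(** Marks the odd faces of spin -1, so that the boundary value +1 becomes 0 and the odd
    configurations form a vector space over F_2. *)
Definition flipped (o : odd_conf) : face -> bool := ext (fun=> false) o.
Definition odd_jump (v : vertex) (o : odd_conf) : bool :=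
  flipped o (oddA v) (+) flipped o (oddB v).

Lemma flipped_notin o x : x \notin F -> flipped o x = false.
Proof. by move=> xF; rewrite /flipped ext_notin // mem_filter (negbTE xF) andbF. Qed.

Lemma odd_jump_character v : character (odd_jump v).
Proof. by move=> o o'; rewrite /odd_jump /flipped !ext_false_add addbACA. Qed.

Lemma odd_jump_notin v o : v \notin D -> odd_jump v o = false.
Proof.
move=> vD; have nF x : x \in [:: fSW v; fSE v; fNW v; fNE v] -> flipped o x = false.
  move=> vx; apply: flipped_notin; apply: contra vD => xF.
  by apply: (mem_dom_vertices xF); apply: corners_diag.
rewrite /odd_jump !nF //; rewrite /oddA /oddB; case: ifP;
  by rewrite !inE eqxx ?orbT.
Qed.

Lemma odd_jump_odd i j o : is_even_face (i, j) = false ->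
  odd_jump (i, j) o = flipped o (i, j) (+) flipped o (i + 1, j + 1).
Proof. by move=> e; rewrite /odd_jump /oddA /oddB e. Qed.

Lemma odd_jump_even i j o : is_even_face (i, j) ->
  odd_jump (i, j) o = flipped o (i, j + 1) (+) flipped o (i + 1, j).
Proof. by move=> e; rewrite /odd_jump /oddA /oddB e. Qed.

(** Along a north-east diagonal of odd faces the jumps determine the increments, and both
    configurations vanish outside [F]. *)
Lemma odd_jump_inj o o' : (forall v, odd_jump v o = odd_jump v o') -> o = o'.
Proof.
move=> oo'; have [B HB] := exists_bound F.
suff H i j : is_odd_face (i, j) -> flipped o (i, j) (+) flipped o' (i, j) = false.
  apply/ffunP => y; have := ssvalP y; rewrite mem_filter => /andP[yo _].
  rewrite -!(ext_val (fun=> false)); have := H (val y).1 (val y).2.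
  by rewrite -surjective_pairing /flipped => /(_ yo); do 2 case: (ext _ _ _).
move=> ij.
pose P k := flipped o (k, k + (j - i)) (+) flipped o' (k, k + (j - i)).
have -> : (i, j) = (i, i + (j - i)) by congr pair; lia.
apply: (@int_shift_false P B) => k.
  have ek : is_even_face (k, k + (j - i)) = false.
    by move: ij; rewrite /is_odd_face /is_even_face /=; lia.
  have := oo' (k, k + (j - i)); rewrite !odd_jump_odd // /P.
  have -> : k + 1 + (j - i) = k + (j - i) + 1 by lia.
  by do 4 case: (flipped _ _).
move=> Bk; rewrite /P !flipped_notin //; apply/negP => /HB /=; lia.
Qed.

Section Component.
Variables (S : face -> bool) (o : odd_conf).
Hypothesis o_compat : forall v, odd_jump v o -> S (evenA v) = S (evenB v).

(** The disagreements inside [S]; thanks to [o_compat], either even face at [v] may be tested. *)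
Definition jumpS v := odd_jump v o && S (evenA v).

Lemma jumpSA v x : x = evenA v -> jumpS v = odd_jump v o && S x.
Proof. by move=> ->. Qed.

Lemma jumpSB v x : x = evenB v -> jumpS v = odd_jump v o && S x.
Proof. by move=> ->; rewrite /jumpS; case: (boolP (odd_jump v o)) => //= /o_compat. Qed.

(* The odd configuration with disagreement set [jumpS], by counting the disagreements
   met on the north-east diagonal ray. *)
Definition potential (x : face) : bool :=
  odd (count (fun v => jumpS v && ((v.1 - v.2 == x.1 - x.2) && (x.1 <= v.1))) D).

Lemma potential_step i j : potential (i, j) = jumpS (i, j) (+) potential (i + 1, j + 1).
Proof.
have -> : jumpS (i, j) = odd (count (fun v => jumpS v && (v == (i, j))) D).
  have [ijD|ijD] := boolP ((i, j) \in D).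
    rewrite (eq_count (a2 := fun v => jumpS (i, j) && (v == (i, j)))).
      case: (jumpS _) => /=; last by rewrite count_pred0.
      by rewrite count_uniq_mem ?undup_uniq // ijD.
    by move=> v; have [->|] //= := eqVneq v (i, j); rewrite !andbF.
  rewrite /jumpS odd_jump_notin //=; rewrite (eq_in_count (a2 := pred0)) ?count_pred0 //.
  by move=> v vD /=; apply/andP => -[_ /eqP vij]; rewrite -vij vD in ijD.
rewrite /potential -oddD; congr odd; elim: D => [//|[k l] s IH] /=.
rewrite {}IH addnACA; congr (_ + _)%N; case: (jumpS _) => //=.
by rewrite xpair_eqE; lia.
Qed.

Lemma potential_bound : exists B : int, forall x, B <= x.1 -> potential x = false.
Proof.
have [B HB] := exists_bound D; exists B => x Bx.
rewrite /potential (eq_in_count (a2 := pred0)) ?count_pred0 // => v /HB vB /=.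
have -> : (x.1 <= v.1) = false by lia.
by rewrite !andbF.
Qed.

(** The four vertices are the corners of the even face (i+1, j+1), so they share the factor [S] of
    that face, and each odd neighbour of it is counted twice. *)
Lemma jumpS_around i j : is_even_face (i, j) ->
  jumpS (i + 1, j + 1) (+) jumpS (i, j + 1) (+) jumpS (i + 1, j) (+) jumpS (i, j) = false.
Proof.
move=> e; have e' : is_even_face (i + 1, j + 1) by rewrite even_horizontal even_vertical e.
have eh : is_even_face (i + 1, j) = false by rewrite even_horizontal e.
have ev : is_even_face (i, j + 1) = false by rewrite even_vertical e.
rewrite (@jumpSA (i + 1, j + 1) (i + 1, j + 1)); last by rewrite /evenA e'.
rewrite (@jumpSB (i, j + 1) (i + 1, j + 1)); last by rewrite /evenB ev.
rewrite (@jumpSA (i + 1, j) (i + 1, j + 1)); last by rewrite /evenA eh.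
rewrite (@jumpSB (i, j) (i + 1, j + 1)); last by rewrite /evenB e.
rewrite !(odd_jump_odd _ ev, odd_jump_odd _ eh, odd_jump_even _ e, odd_jump_even _ e').
by case: (S _); rewrite ?andbF // !andbT; do 4 case: (flipped _ _).
Qed.

(** The potential has the right jumps on north-east diagonals by construction. On the other
    diagonals, [jumpS_around] makes the defect constant along a diagonal, and it vanishes far
    away. *)
Lemma potential_even i j : is_even_face (i, j) ->
  potential (i, j + 1) (+) potential (i + 1, j) = jumpS (i, j).
Proof.
move=> e; have [B HB] := potential_bound; have [C HC] := exists_bound D.
pose P k := potential (k, k + (j - i) + 1) (+) potential (k + 1, k + (j - i))
             (+) jumpS (k, k + (j - i)).
suff : P i = false.
  rewrite /P; have -> : i + (j - i) = j by lia.
  by move/eqP; rewrite eqbF_neg negb_add => /eqP.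
apply: (@int_shift_false P (Num.max B C)) => k.
  have ek : is_even_face (k, k + (j - i)).
    by move: e; rewrite /is_even_face /=; lia.
  rewrite /P (potential_step k) (potential_step (k + 1) (k + (j - i))).
  have := jumpS_around ek.
  have -> : k + 1 + (j - i) = k + (j - i) + 1 by lia.
  by do 4 case: (jumpS _); do 2 case: (potential _).
rewrite ge_max => /andP[Bk Ck]; rewrite /P !HB //=; last by lia.
by rewrite /jumpS odd_jump_notin //; apply/negP => /HC /=; lia.
Qed.

Lemma potential_jump v : potential (oddA v) (+) potential (oddB v) = jumpS v.
Proof.
case: v => i j; rewrite /oddA /oddB; case: ifP => e; first exact: potential_even.
by rewrite /fSW /fNE /= potential_step addbK.
Qed.

(* Around an even face z, the potential differs from the configuration (if S z), or from
   0 (otherwise), by a constant. This value extends the potential to the even exterior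
   faces as a locally constant function. *)
Definition corrected z (x : face) := potential x (+) (S z && flipped o x).

Lemma corrected_jump v z : z = evenA v \/ z = evenB v ->
  corrected z (oddA v) = corrected z (oddB v).
Proof.
move=> vz; have Jz : jumpS v = odd_jump v o && S z.
  by case: vz; [exact: jumpSA|exact: jumpSB].
have := potential_jump v; rewrite Jz /corrected /odd_jump.
by do 2 case: (potential _); do 2 case: (flipped _ _); case: (S z).
Qed.

Lemma corrected_around i j : is_even_face (i, j) ->
  [/\ corrected (i, j) (i - 1, j) = corrected (i, j) (i + 1, j),
      corrected (i, j) (i, j + 1) = corrected (i, j) (i + 1, j) &
      corrected (i, j) (i, j - 1) = corrected (i, j) (i + 1, j)].
Proof.
move=> e.
have eW : is_even_face (i - 1, j) = false by move: e; rewrite /is_even_face /=; lia.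
have eS : is_even_face (i, j - 1) = false by move: e; rewrite /is_even_face /=; lia.
have eSW : is_even_face (i - 1, j - 1) by move: e; rewrite /is_even_face /=; lia.
have NE := @corrected_jump (i, j) (i, j).
have SE := @corrected_jump (i, j - 1) (i, j).
have NW := @corrected_jump (i - 1, j) (i, j).
rewrite /oddA /oddB /evenA /evenB e /fSW /fNE /fNW /fSE /= in NE.
rewrite /oddA /oddB /evenA /evenB eS /fSW /fNE /fNW /fSE /= subrK in SE.
rewrite /oddA /oddB /evenA /evenB eW /fSW /fNE /fNW /fSE /= subrK in NW.
have {}NE := NE (or_introl erefl).
have {}SE := SE (or_introl erefl).
have {}NW := NW (or_intror erefl).
by rewrite -NE NW SE NE.
Qed.

(** Of two adjacent exterior faces one is even, say z, and at the other [corrected z] equals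
    [potential] because [flipped] vanishes there. So [h] below is locally constant outside [F], and
    connectedness of the exterior applies. *)
Lemma potential_exterior x : is_odd_face x -> x \notin F -> potential x = false.
Proof.
move=> xo xF; have [B HB] := potential_bound; have [C HC] := exists_bound F.
pose h x := if x \in F then false else
            if is_odd_face x then potential x else corrected x (x.1 + 1, x.2).
have <- : h x = potential x by rewrite /h (negbTE xF) xo.
have corr z y : y \notin F -> corrected z y = potential y.
  by move=> yF; rewrite /corrected flipped_notin // andbF addbF.
apply: (exterior_connected scyc FE (B := Num.max B C)) => [y yF|i j ijF ijF'|i j ijF ijF'|i j].
- by rewrite /h yF.
- rewrite /h (negbTE ijF) (negbTE ijF') !is_odd_faceE even_horizontal negbK /=.
  case: ifP => e; last by rewrite (negbFE e) corr.
  rewrite (negbTE e); have [] := @corrected_around (i + 1) j; first by rewrite even_horizontal.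
  by rewrite addrK => <- _ _; rewrite corr.
- rewrite /h (negbTE ijF) (negbTE ijF') !is_odd_faceE even_vertical negbK /=.
  case: ifP => e.
    rewrite (negbTE e); have [] := @corrected_around i (j + 1); first by rewrite even_vertical.
    by rewrite addrK => _ _ <-; rewrite corr.
  move/negbFE: e => e; rewrite e.
  by have [_ <- _] := corrected_around e; rewrite corr.
rewrite ge_max => /andP[Bi Ci]; rewrite /h; case: ifP => // _.
case: ifP => _; first exact: HB.
by rewrite corr; [apply: HB => /=; lia|apply/negP => /HC /=; lia].
Qed.

Lemma component_exists :
  exists p : odd_conf, forall v, odd_jump v p = odd_jump v o && S (evenA v).
Proof.
exists [ffun y => potential (val y)] => v; rewrite -/(jumpS v) -potential_jump.
have fE x : is_odd_face x -> flipped [ffun y => potential (val y)] x = potential x.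
  move=> xo; have [xF|xF] := boolP (x \in F); last first.
    by rewrite flipped_notin // potential_exterior.
  have xFo : x \in Fo by rewrite mem_filter xo.
  by rewrite -[x]/(val (SeqSub xFo)) /flipped ext_val ffunE.
by rewrite /odd_jump !fE ?oddA_odd ?oddB_odd.
Qed.

End Component.

Section Factorization.
Variables (R : realFieldType) (S : face -> bool) (t : vertex -> R).

Let tS v := if S (evenA v) && S (evenB v) then t v else 0.
Let tN v := if ~~ S (evenA v) && ~~ S (evenB v) then t v else 0.

(** In the expanded product the second variable is written x + y. For fixed [y] all terms vanish
    except the one where [x] is the part of [y] inside [S]. *)
Lemma code_sum_split :
  code_sum D odd_jump (fun v => if S (evenA v) == S (evenB v) then t v else 0) =
  code_sum D odd_jump tS * code_sum D odd_jump tN.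
Proof.
rewrite /code_sum mulr_suml.
transitivity (\sum_x \sum_y \prod_(v <- D)
    (tS v ^+ odd_jump v x * tN v ^+ (odd_jump v x (+) odd_jump v y))); last first.
  apply: eq_bigr => x _; rewrite mulr_sumr [RHS](reindex_inj (addrI x)).
  apply: eq_bigr => y _; rewrite -big_split; apply: eq_bigr => v _.
  by rewrite odd_jump_character.
rewrite exchange_big /=; apply: eq_bigr => y _.
have prod0 (f : vertex -> R) v : v \in D -> f v = 0 -> \prod_(v <- D) f v = 0.
  by move=> vD fv; apply/eqP; rewrite prodf_seq_eq0; apply/hasP; exists v; rewrite ?fv /=.
have [compat|] := pselect (forall v, odd_jump v y -> S (evenA v) = S (evenB v)); last first.
  (* At such a [v] both [tS] and [tN] are 0 and one of the two exponents is 1, so both sides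
     vanish. *)
  move=> /existsNP[v /not_implyP[vy Sv]].
  have vD : v \in D by apply: contraPT vy => /odd_jump_notin ->.
  rewrite (@prod0 _ v) //; last by rewrite vy; case: eqP.
  rewrite big1 // => x _; apply: (@prod0 _ v) => //; rewrite /tS /tN vy.
  by case: (odd_jump v x); move: Sv; case: (S _); case: (S _); rewrite //= ?mul0r ?mulr0.
have [p pE] := component_exists compat.
rewrite (bigD1 p) //= [X in _ + X]big1 ?addr0 => [|x xp].
  apply: eq_bigr => v _; rewrite pE /tS /tN; have := compat v.
  case: (odd_jump v y) => /= [/(_ isT) <-|_]; last by rewrite !expr0 mulr1.
  by rewrite eqxx; case: (S _); rewrite /= ?expr0 ?expr1 ?mulr1 ?mul1r.
have [v vxp] : exists v, odd_jump v x != odd_jump v p.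
  apply: contrapT => /forallNP H; move/eqP: xp; apply; apply: odd_jump_inj => v.
  by apply/eqP; apply/negPn/negP; exact: H.
have vD : v \in D by apply: contraNT vxp => vD; rewrite !odd_jump_notin.
apply: (@prod0 _ v) => //; move: vxp; rewrite pE /tS /tN; have := compat v.
case: (odd_jump v y) => /= [/(_ isT) <-|_];
  by case: (odd_jump v x); case: (S _); case: (S _); rewrite //= ?mul0r ?mulr0.
Qed.

End Factorization.
End Splitting.

(** * The even marginal *)

Lemma code_sum_gt0 (R : realFieldType) (I : finType) (E : Type) (s : seq E)
    (d : E -> {ffun I -> bool} -> bool) (t : E -> R) :
  (forall e, character (d e)) -> (forall e, 0 <= t e) -> 0 < code_sum s d t.
Proof.
move=> dc t0; rewrite /code_sum (bigD1 (0 : {ffun I -> bool})) //= ltr_pwDl //.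
  rewrite big1 ?ltr01 // => e _.
  have -> : d e 0 = false by have := dc e 0 0; rewrite addr0; case: (d e 0).
  by rewrite expr0.
by apply: sumr_ge0 => x _; apply: prodr_ge0 => e _; apply: exprn_ge0.
Qed.

Lemma expr_count (R : comNzRingType) (T : Type) (x : R) (P : pred T) (s : seq T) :
  x ^+ count P s = \prod_(v <- s) (if P v then x else 1).
Proof.
elim: s => [|v s IH]; first by rewrite big_nil.
by rewrite big_cons -IH /=; case: (P v); rewrite ?exprS ?mul1r.
Qed.

Section Marginal.
Variables (R : realType) (cyc : seq vertex) (F : seq face).
Variables (tau : face -> bool) (a b c : R).
Hypothesis scyc : simple_cycle cyc.
Hypothesis FE : forall x : face, (x \in F) = enclosed cyc x.
Hypothesis tau_odd : forall x : face, is_odd_face x -> x \notin F -> tau x = true.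
Hypotheses (a0 : 0 < a) (b0 : 0 < b) (c0 : 0 < c) (ac : a <= c) (bc : b <= c).

Local Notation Fe := [seq x <- F | is_even_face x].
Local Notation Fo := [seq x <- F | is_odd_face x].
Local Notation D := (dom_vertices F).
Local Notation even_conf := {ffun seq_sub Fe -> bool}.
Local Notation odd_conf := {ffun seq_sub Fo -> bool}.

Definition conf (e : even_conf) (o : odd_conf) (x : face) : bool :=
  if is_even_face x then ext tau e x else ~~ flipped o x.

Definition merge (eo : even_conf * odd_conf) : {ffun seq_sub F -> bool} :=
  [ffun y => conf eo.1 eo.2 (val y)].

Definition unmerge (eta : {ffun seq_sub F -> bool}) : even_conf * odd_conf :=
  ([ffun y => ext tau eta (val y)], [ffun y => ~~ ext tau eta (val y)]).

(** The boundary condition enters here: odd faces outside [F] have spin +1, which is what [flipped]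
    encodes by [false]. *)
Lemma ext_merge e o : ext tau (merge (e, o)) = conf e o.
Proof.
apply/funext => x; have [xF|xF] := boolP (x \in F).
  by rewrite -[x]/(val (SeqSub xF)) ext_val ffunE.
rewrite ext_notin // /conf flipped_notin // ext_notin ?mem_filter ?(negbTE xF) ?andbF //.
by case: ifP => // xe; rewrite tau_odd // is_odd_faceE xe.
Qed.

Lemma merge_bij : bijective merge.
Proof.
exists unmerge => [[e o]|eta].
  rewrite /unmerge ext_merge; congr pair; apply/ffunP => y; rewrite ffunE /conf.
    by have := ssvalP y; rewrite mem_filter => /andP[-> _]; rewrite ext_val.
  have := ssvalP y; rewrite mem_filter is_odd_faceE => /andP[/negbTE -> _].
  by rewrite /flipped ext_val negbK.
apply/ffunP => y; rewrite ffunE /conf /= -[RHS](ext_val tau).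
have yF := ssvalP y; case: ifP => ye.
  have yFe : val y \in Fe by rewrite mem_filter ye.
  by rewrite -[X in ext tau _ X]/(val (SeqSub yFe)) ext_val ffunE.
have yFo : val y \in Fo by rewrite mem_filter is_odd_faceE ye.
by rewrite -[X in flipped _ X]/(val (SeqSub yFo)) /flipped ext_val ffunE negbK.
Qed.

Lemma sum_conf (G : {ffun seq_sub F -> bool} -> R) :
  \sum_eta G eta = \sum_e \sum_o G (merge (e, o)).
Proof.
rewrite (reindex merge) /=; last by apply: onW_bij; exact: merge_bij.
by rewrite pair_bigA /=; apply: eq_bigr => -[].
Qed.

Definition even_agree (e : even_conf) (v : vertex) :=
  ext tau e (evenA v) == ext tau e (evenB v).
(** At a vertex of even index the even diagonal is the south-west/north-east one, so breaking it
    gives type b and breaking the odd one type a; at the other vertices the types are exchanged. *)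
Definition even_break_weight (v : vertex) := if is_even_face v then b else a.
Definition odd_break_ratio (v : vertex) := (if is_even_face v then a else b) / c.
Definition even_weight (e : even_conf) :=
  \prod_(v <- D) (if even_agree e v then c else even_break_weight v).

(** The base 0 at vertices with disagreeing even spins encodes [E_spin]. Vertices outside the domain
    impose nothing more, since the odd spins never disagree there. *)
Lemma spin_weightE e o : spin_weight tau a b c (merge (e, o)) =
  even_weight e *
  \prod_(v <- D) (if even_agree e v then odd_break_ratio v else 0) ^+ odd_jump v o.
Proof.
have diag v : is_even_face v -> diagA (conf e o) v = even_agree e v /\
    diagB (conf e o) v = ~~ odd_jump v o.
  move=> ve; have := oddA_odd v; have := oddB_odd v; have := evenA_even v; have := evenB_even v.
  rewrite /diagA /diagB /conf /even_agree /odd_jump /evenA /evenB /oddA /oddB ve !is_odd_faceE.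
  by move=> -> -> /negbTE -> /negbTE ->; case: (flipped _ _); case: (flipped _ _).
have diag' v : is_even_face v = false -> diagB (conf e o) v = even_agree e v /\
    diagA (conf e o) v = ~~ odd_jump v o.
  move=> ve; have := oddA_odd v; have := oddB_odd v; have := evenA_even v; have := evenB_even v.
  rewrite /diagA /diagB /conf /even_agree /odd_jump /evenA /evenB /oddA /oddB ve !is_odd_faceE.
  by move=> -> -> /negbTE -> /negbTE ->; case: (flipped _ _); case: (flipped _ _).
have diagE v : diagA (conf e o) v || diagB (conf e o) v = even_agree e v || ~~ odd_jump v o.
  case ve : (is_even_face v); first by have [-> ->] := diag v ve.
  by have [-> ->] := diag' v ve; rewrite orbC.
rewrite /spin_weight ext_merge; case: asboolP => [sE|nE]; last first.
  move/existsNP: nE => [v /negP]; rewrite diagE negb_or negbK => /andP[vA vJ].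
  have vD : v \in D by apply: contraTT vJ => /odd_jump_notin ->.
  rewrite [X in _ * X](_ : _ = 0) ?mulr0 //.
  by apply/eqP; rewrite prodf_seq_eq0; apply/hasP; exists v; rewrite //= (negbTE vA) vJ.
rewrite !expr_count -!big_split; apply: eq_bigr => v _ /=.
have := sE v; rewrite diagE /type_a /type_b /type_c /even_break_weight /odd_break_ratio.
have c1 : c != 0 by rewrite gt_eqF.
case ve : (is_even_face v); [have [-> ->] := diag v ve|have [-> ->] := diag' v ve];
  case: (even_agree e v); case: (odd_jump v o) => //= _;
  by rewrite ?expr0 ?expr1 ?mulr1 ?mul1r // mulrC divfK.
Qed.

Definition cluster_sum (s : bool) (e : even_conf) : R :=
  code_sum D (@odd_jump F) (fun v =>
    if (ext tau e (evenA v) == s) && (ext tau e (evenB v) == s)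
    then odd_break_ratio v else 0).

Definition marginal_weight (e : even_conf) : R :=
  even_weight e * (cluster_sum true e * cluster_sum false e).

Lemma sum_odd_weight e :
  \sum_o spin_weight tau a b c (merge (e, o)) = marginal_weight e.
Proof.
rewrite (eq_bigr _ (fun o _ => spin_weightE e o)) -mulr_sumr; congr (_ * _).
have := code_sum_split scyc FE (ext tau e) odd_break_ratio.
rewrite /code_sum => ->; rewrite /cluster_sum /code_sum.
congr (_ * _); apply: eq_bigr => x _; apply: eq_bigr => v _;
  by do 2 case: (ext _ _ _).
Qed.

Lemma odd_break_ratio01 v : 0 <= odd_break_ratio v <= 1.
Proof.
rewrite /odd_break_ratio ler_pdivrMr // mul1r; apply/andP; split; last by case: ifP.
by apply: divr_ge0; [case: ifP => _|]; exact: ltW.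
Qed.

Lemma even_weight_gt0 e : 0 < even_weight e.
Proof.
by apply: prodr_gt0 => v _; case: ifP => // _; rewrite /even_break_weight; case: ifP.
Qed.

Lemma cluster_sum_gt0 s e : 0 < cluster_sum s e.
Proof.
apply: code_sum_gt0 => v; first exact: odd_jump_character.
by case: ifP => // _; case/andP: (odd_break_ratio01 v).
Qed.

Lemma marginal_weight_gt0 e : 0 < marginal_weight e.
Proof. by rewrite !mulr_gt0 ?even_weight_gt0 ?cluster_sum_gt0. Qed.

Lemma ext_fjoin (e f : even_conf) x : ext tau (fjoin e f) x = ext tau e x || ext tau f x.
Proof. by rewrite /ext; case: insub => [y|]; rewrite ?ffunE ?orbb. Qed.

Lemma ext_fmeet (e f : even_conf) x : ext tau (fmeet e f) x = ext tau e x && ext tau f x.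
Proof. by rewrite /ext; case: insub => [y|]; rewrite ?ffunE ?andbb. Qed.

(** The inequality holds vertex by vertex, with equality unless [e] and [f] break the diagonal in
    opposite ways; then join and meet both agree, and a, b <= c is used. *)
Lemma even_weight_supermodular e f :
  even_weight e * even_weight f <= even_weight (fjoin e f) * even_weight (fmeet e f).
Proof.
rewrite /even_weight -!big_split; apply: ler_prod => v _ /=.
have [p0 pc] : 0 < even_break_weight v /\ even_break_weight v <= c.
  by rewrite /even_break_weight; case: ifP.
apply/andP; split; first by apply: mulr_ge0; case: ifP => _; exact: ltW.
rewrite /even_agree !ext_fjoin !ext_fmeet.
do 4 case: (ext _ _ _) => /=; rewrite ?lexx //.
all: by [rewrite mulrC|apply: ler_pM => //; exact: ltW].
Qed.

(** For spin +1, an edge inside either cluster lies inside their union, and the edges inside both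
    are those inside the intersection. So the join dominates the maximum of the weights and the meet
    equals their minimum. *)
Lemma cluster_sum_supermodular s e f :
  cluster_sum s e * cluster_sum s f <= cluster_sum s (fjoin e f) * cluster_sum s (fmeet e f).
Proof.
apply: le_trans (code_sum_supermodular _ _ _ _) _.
- exact: odd_jump_character.
- by move=> v; case: ifP => _; rewrite ?odd_break_ratio01 // lexx ler01.
- by move=> v; case: ifP => _; rewrite ?odd_break_ratio01 // lexx ler01.
have q0 v : 0 <= odd_break_ratio v by case/andP: (odd_break_ratio01 v).
(* For spin -1 the clusters are complements, so join and meet exchange roles. *)
case: s; last rewrite [leRHS]mulrC.
all: apply: ler_pM; do ?[apply: code_sum_ge0|apply: ler_code_sum] => v.
all: rewrite ?ext_fjoin ?ext_fmeet.
all: case: (ext tau e (evenA v)); case: (ext tau e (evenB v)).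
all: case: (ext tau f (evenA v)); case: (ext tau f (evenB v)) => /=.
all: by rewrite ?maxxx ?minxx ?(max_l (q0 v)) ?(max_r (q0 v)) ?(min_l (q0 v))
  ?(min_r (q0 v)) ?lexx ?q0.
Qed.

Lemma marginal_weight_supermodular e f :
  marginal_weight e * marginal_weight f <=
  marginal_weight (fjoin e f) * marginal_weight (fmeet e f).
Proof.
rewrite /marginal_weight mulrACA [leRHS]mulrACA.
have w0 := even_weight_gt0; have s0 := cluster_sum_gt0.
apply: ler_pM; [by rewrite mulr_ge0 // ltW|by rewrite !mulr_ge0 // ltW| |].
  exact: even_weight_supermodular.
rewrite mulrACA [leRHS]mulrACA.
apply: ler_pM; [by rewrite mulr_ge0 // ltW|by rewrite mulr_ge0 // ltW| |];
  exact: cluster_sum_supermodular.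
Qed.

(** * Transfer to the marginal on configurations of all even faces *)

Definition even_spins (e : even_conf) : even_face -> bool := fun p => ext tau e (sval p).

Lemma restr_even_merge e o : restr_even (ext tau (merge (e, o))) = even_spins e.
Proof. by apply/funext => -[x xe]; rewrite ext_merge /restr_even /conf /even_spins /= xe. Qed.

Lemma even_spins_inj : injective even_spins.
Proof.
move=> e f ef; apply/ffunP => y; have := ssvalP y; rewrite mem_filter => /andP[ye _].
by have := congr1 (fun s => s (exist _ (val y) ye)) ef; rewrite /even_spins /= !ext_val.
Qed.

Lemma even_spins_join e f : even_spins (fjoin e f) = conf_join (even_spins e) (even_spins f).
Proof. by apply/funext => p; rewrite /even_spins ext_fjoin. Qed.

Lemma even_spins_meet e f : even_spins (fmeet e f) = conf_meet (even_spins e) (even_spins f).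
Proof. by apply/funext => p; rewrite /even_spins ext_fmeet. Qed.

Lemma even_spins_le (e f : even_conf) :
  (forall i, e i ==> f i) -> conf_le (even_spins e) (even_spins f).
Proof.
by move=> ef p; rewrite /even_spins /ext; case: insub => [y|]; rewrite ?ef ?implybb.
Qed.

Lemma spin_Z_marginal : spin_Z F tau a b c = \sum_e marginal_weight e.
Proof.
by rewrite /spin_Z sum_conf; apply: eq_bigr => e _; rewrite sum_odd_weight.
Qed.

Lemma spin_Z_gt0 : 0 < spin_Z F tau a b c.
Proof.
rewrite spin_Z_marginal (bigD1 [ffun=> true]) //= ltr_pwDl ?marginal_weight_gt0 //.
by apply: sumr_ge0 => e _; rewrite ltW ?marginal_weight_gt0.
Qed.

Lemma spin_E_marginal (f : (even_face -> bool) -> R) :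
  spin_E F tau a b c (fun s => f (restr_even s)) =
  (\sum_e marginal_weight e * f (even_spins e)) / spin_Z F tau a b c.
Proof.
rewrite /spin_E sum_conf mulr_suml; apply: eq_bigr => e _.
rewrite -sum_odd_weight !mulr_suml; apply: eq_bigr => o _.
by rewrite restr_even_merge mulrAC.
Qed.

Lemma spin_marginal_even_spins e :
  spin_marginal F tau a b c (even_spins e) = marginal_weight e / spin_Z F tau a b c.
Proof.
rewrite /spin_marginal (spin_E_marginal (fun s => if `[< s = even_spins e >] then 1 else 0)).
congr (_ / _); rewrite (bigD1 e) //= big1 ?addr0 => [|f fe]; first by rewrite asboolT // mulr1.
by rewrite asboolF ?mulr0 // => /even_spins_inj; apply/eqP.
Qed.

Lemma spin_marginal_eq0 xi :
  (forall e, xi <> even_spins e) -> spin_marginal F tau a b c xi = 0.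
Proof.
move=> xie; rewrite /spin_marginal (spin_E_marginal (fun s => if `[< s = xi >] then 1 else 0)).
by rewrite big1 ?mul0r // => e _; rewrite asboolF ?mulr0 // => /esym /xie.
Qed.

Lemma spin_marginal_ge0 xi : 0 <= spin_marginal F tau a b c xi.
Proof.
have [[e ->]|nxi] := pselect (exists e, xi = even_spins e).
  by rewrite spin_marginal_even_spins divr_ge0 // ltW ?marginal_weight_gt0 ?spin_Z_gt0.
by rewrite spin_marginal_eq0 // => e xie; apply: nxi; exists e.
Qed.

(** The image of [even_spins] is a sublattice carrying all the mass; if [xi1] or [xi2] lies outside
    it, the left-hand side is 0. *)
Lemma spin_marginal_fkg_lattice xi1 xi2 :
  spin_marginal F tau a b c xi1 * spin_marginal F tau a b c xi2 <=
  spin_marginal F tau a b c (conf_join xi1 xi2) *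
  spin_marginal F tau a b c (conf_meet xi1 xi2).
Proof.
have [[e ->]|n1] := pselect (exists e, xi1 = even_spins e); last first.
  by rewrite spin_marginal_eq0 ?mul0r ?mulr_ge0 ?spin_marginal_ge0 // => e ?; apply: n1; exists e.
have [[f ->]|n2] := pselect (exists f, xi2 = even_spins f); last first.
  by rewrite [X in _ * X]spin_marginal_eq0 ?mulr0 ?mulr_ge0 ?spin_marginal_ge0 // => f ?;
    apply: n2; exists f.
rewrite -even_spins_join -even_spins_meet !spin_marginal_even_spins.
rewrite mulrACA [leRHS]mulrACA ler_wpM2r ?marginal_weight_supermodular //.
by rewrite mulr_ge0 // invr_ge0 ltW ?spin_Z_gt0.
Qed.

Lemma spin_E_positive_association (f g : (even_face -> bool) -> R) :
  increasing f -> increasing g ->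
  spin_E F tau a b c (fun s => f (restr_even s)) *
  spin_E F tau a b c (fun s => g (restr_even s)) <=
  spin_E F tau a b c (fun s => f (restr_even s) * g (restr_even s)).
Proof.
move=> incf incg; have Z0 := spin_Z_gt0.
rewrite (spin_E_marginal (fun s => f s * g s)) !spin_E_marginal.
(* Clearing denominators leaves one factor [spin_Z], which is the total mass in [fkg]. *)
rewrite mulrACA mulrA ler_pM2r ?invr_gt0 // ler_pdivrMr // spin_Z_marginal.
apply: fkg => [e|e e'|e e' ee'|e e' ee'].
- by rewrite ltW ?marginal_weight_gt0.
- exact: marginal_weight_supermodular.
- by apply: incf; exact: even_spins_le.
- by apply: incg; exact: even_spins_le.
Qed.

End Marginal.

Theorem theorem2p5 (R : realType) (cyc : seq vertex) (F : seq face)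
  (tau : face -> bool) (a b c : R) :
  simple_cycle cyc ->
  uniq F -> (forall x : face, (x \in F) = enclosed cyc x) ->
  E_spin tau ->
  (forall x : face, is_odd_face x -> x \notin F -> tau x = true) ->
  0 < a -> 0 < b -> 0 < c -> a <= c -> b <= c ->
  (forall xi1 xi2 : even_face -> bool,
     spin_marginal F tau a b c (conf_join xi1 xi2) *
     spin_marginal F tau a b c (conf_meet xi1 xi2)
     >= spin_marginal F tau a b c xi1 * spin_marginal F tau a b c xi2)
  /\
  (forall f g : (even_face -> bool) -> R, increasing f -> increasing g ->
     spin_E F tau a b c (fun s => f (restr_even s) * g (restr_even s))
     >= spin_E F tau a b c (fun s => f (restr_even s)) *
        spin_E F tau a b c (fun s => g (restr_even s))).
Proof.
move=> scyc _ FE _ tau_odd a0 b0 c0 ac bc; split=> [xi1 xi2|f g incf incg].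
  exact: (spin_marginal_fkg_lattice scyc FE).
exact: (spin_E_positive_association scyc FE).
Qed.
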